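(* Let $\mathcal{H}$ be a complex Hilbert space (not necessarily separable) with $\dim_{\mathbb{C}}\mathcal{H}\ge 2$. Let $E$ and $F$ be events on $\mathcal{H}$ and let $\psi\in\mathbb{S}(\mathcal{H})$. Put ${\rm P}_\psi(E,F) := \|FE\psi\|^2$, $x:=\pi_2(\psi)$, $S:=\pi'(E)$ and $S':=\pi'(F)$. (1) If $x\notin S^\perp$ (equivalently, $E\psi\ne 0$) and $S'\neq\emptyset$, then $${\rm P}_\psi(E,F) = \cos^2 d(y,S')\,\cos^2 d(x,S), \qquad \text{where } y = {\rm Pj}(x\downarrow S).$$ (2) If $x\in S^\perp$ (equivalently, $E\psi=0$), then ${\rm P}_\psi(E,F)=0$.
   Context: The Hermitian inner product $\langle\cdot,\cdot\rangle$ on $\mathcal{H}$ is conjugate linear in the first entry and linear in the second; $\|\cdot\|$ is its norm. Write $V^{\rm x} = V\setminus\{0\}$ for a vector space $V$, $\mathbb{S}(\mathcal{H}) = \{\psi\in\mathcal{H} : \|\psi\|=1\}$, and $\mathbb{CP}(\mathcal{H}) = \mathcal{H}^{\rm x}/\mathbb{C}^{\rm x} = \mathbb{S}(\mathcal{H})/S^1$, where $S^1$ is the group of unit complex numbers. The quotient maps are $\pi_2:\mathbb{S}(\mathcal{H})\to\mathbb{CP}(\mathcal{H})$ and $\pi_3:\mathcal{H}^{\rm x}\to\mathbb{CP}(\mathcal{H})$, $\pi_3(\psi)=\pi_2(\psi/\|\psi\|)$. For $x,y\in\mathbb{CP}(\mathcal{H})$, $|\langle x,y\rangle| := |\langle\psi,\phi\rangle|\in[0,1]$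 for any unit vectors $\psi\in\pi_2^{-1}(x)$, $\phi\in\pi_2^{-1}(y)$ (well defined). One writes $x\perp y$ if $|\langle x,y\rangle|=0$, and for a subset $X\subset\mathbb{CP}(\mathcal{H})$, $X^\perp := \{y\in\mathbb{CP}(\mathcal{H}) : x\perp y \text{ for all } x\in X\}$. Distance: $d(x,y)$ is the distance on $\mathbb{CP}(\mathcal{H})$ (infimum of lengths of $C^1$ curves) associated with the Fubini-Study Riemannian metric, normalized so that $\pi_2$ is a Riemannian submersion from the unit sphere $\mathbb{S}(\mathcal{H})$ with the metric induced from the real inner product $\Re\langle\cdot,\cdot\rangle$; it is a known fact that $d(x,y)=\cos^{-1}|\langle x,y\rangle|\in[0,\pi/2]$ for all $x,y$. For a non-empty subset $Y\subset\mathbb{CP}(\mathcal{H})$, $d(x,Y):=\inf\{d(x,y) : y\in Y\}$. Events and projective subspaces: an event is a bounded linear operator $E$ on $\mathcal{H}$ with $E=E^2=E^*$ (an orthogonal projection). A (complex) projective subspace of $\mathbb{CP}(\mathcal{H})$ is a set of the form $\pi_3(V^{\rm x})$ for a (unique) closed complex vector subspace $V$ of $\mathcal{H}$. The map $\pi'(E):=\pi_3(({\rm Ran}\,E)^{\rm x})$ is a bijection from events to projective subspaces, with $\pi'(0)=\emptyset$. Projection: for a non-empty projective subspace $S$ and $x\in\mathbb{CP}(\mathcal{H})$ with $x\notin S^\perp$, there is a unique point $y\in S$ with $d(x,y)=d(x,S)$; this point is denoted ${\rm Pj}(x\downarrow S)$. (If $x\notin S^\perp$ then $S$ is automatically non-empty.)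 *)

(* Defs.v *)
From HB Require Import structures.
From mathcomp Require Import all_boot all_order all_algebra.
From mathcomp Require Import complex.
From mathcomp Require Import all_classical all_reals all_analysis.

Set Implicit Arguments.
Unset Strict Implicit.
Unset Printing Implicit Defensive.

Import Order.TTheory GRing.Theory Num.Theory.
Import numFieldNormedType.Exports.

Local Open Scope classical_set_scope.
Local Open Scope ring_scope.
Local Open Scope complex_scope.
Local Open Scope quotient_scope.

(* The inner product is conjugate linear in its first argument and linear in
   its second one; positive definiteness follows from [inner_norm]. *)
HB.mixin Record hasInner (R : realType) H of NormedModule R[i] H := {
  inner : H -> H -> R[i];
  innerDr : forall x y z : H, inner x (y + z) = inner x y + inner x z;
  innerZr : forall (a : R[i]) (x y : H), inner x (a *: y) = a * inner x y;
  inner_conj : forall x y : H, inner y x = (inner x y)^*%C;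
  inner_norm : forall x : H, inner x x = `|x| ^+ 2
}.

#[short(type="hilbertType")]
HB.structure Definition Hilbert (R : realType) :=
  { H of CompleteNormedModule R[i] H & hasInner R H }.

(* Norms take their values in the nonnegative reals of [R[i]]; [rnorm] is the
   same norm, valued in [R]. *)
Definition rnorm (R : realType) (V : normedModType R[i]) (v : V) : R :=
  complex.Re `|v|.

Section ProjectiveSpace.
Context {R : realType} (H : hilbertType R).

(* S(H), H^x and, below, CP(H) as the quotient S(H)/S^1. *)
Record sphere := Sphere { sphere_val :> H; _ : `|sphere_val| == 1 }.
HB.instance Definition _ := [isSub for sphere_val].
HB.instance Definition _ := [Choice of sphere by <:].

Record nonzero := Nonzero { nonzero_val :> H; _ : nonzero_val != 0 }.
HB.instance Definition _ := [isSub for nonzero_val].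
HB.instance Definition _ := [Choice of nonzero by <:].

Definition phase_eq (psi phi : sphere) : bool :=
  `[< exists u : R[i], `|u| = 1 /\ phi = u *: (psi : H) :> H >].

Lemma phase_eq_refl : reflexive phase_eq.
Proof. by move=> x; apply/asboolP; exists 1; rewrite normr1 scale1r. Qed.

Lemma phase_eq_sym : symmetric phase_eq.
Proof.
suff imp x y : phase_eq x y -> phase_eq y x by move=> x y; apply/idP/idP => /imp.
move=> /asboolP[u [u1 yE]]; apply/asboolP; exists u^-1.
have u0 : u != 0 by rewrite -normr_gt0 u1 ltr01.
by rewrite normfV u1 invr1 yE scalerA mulVf// scale1r.
Qed.

Lemma phase_eq_trans : transitive phase_eq.
Proof.
move=> y x z /asboolP[u [u1 yE]] /asboolP[v [v1 zE]].
by apply/asboolP; exists (v * u); rewrite normrM u1 v1 mulr1 zE yE scalerA.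
Qed.

Canonical phase_equiv :=
  EquivRel phase_eq phase_eq_refl phase_eq_sym phase_eq_trans.

Definition cp := {eq_quot phase_equiv}.
HB.instance Definition _ := Choice.on cp.
HB.instance Definition _ := EqQuotient.on cp.

Definition pi2 (psi : sphere) : cp := \pi_cp psi.

Lemma normalize_subproof (v : nonzero) :
  let w : H := nonzero_val v in `|(`|w|)^-1 *: w| == 1.
Proof.
case: v => v v0 /=.
by rewrite normrZ normfV normr_id mulVf// normr_eq0.
Qed.

Definition pi3 (v : nonzero) : cp := pi2 (Sphere (normalize_subproof v)).

(* |<x, y>| does not depend on the chosen unit representatives. *)
Definition cp_absinner (x y : cp) : R :=
  complex.Re `|inner (repr x : H) (repr y : H)|.

Definition cp_perp (x y : cp) : Prop := cp_absinner x y = 0.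

Definition cp_orth (X : set cp) : set cp :=
  [set y | forall x, X x -> cp_perp x y].

(* [has_deriv c t v] : the curve [c], restricted to [0, 1], has derivative [v]
   at [t]; the derivative is one-sided at the end points. *)
Definition has_deriv (c : R -> H) (t : R) (v : H) : Prop :=
  ((s - t)^-1)%:C *: (c s - c t) @[s --> within `[0, 1] t^'] --> v.

(* [local_lift g t c c'] : near [t] in [0, 1], [c] is a C^1 curve in S(H), with
   derivative [c'], that lifts [g] along [pi2]. *)
Definition local_lift (g : R -> cp) (t : R) (c : R -> sphere) (c' : R -> H) :=
  \forall s \near within `[0, 1] (nbhs t),
    [/\ pi2 (c s) = g s,
        has_deriv (fun r => c r : H) s (c' s) &
        c' r @[r --> within `[0, 1] (nbhs s)] --> c' s].

(* As [pi2] is a submersion, a curve [0, 1] -> CP(H) is C^1 iff it lifts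
   locally to C^1 curves in S(H). Values of [g] outside [0, 1] are ignored. *)
Definition C1_curve (g : R -> cp) : Prop :=
  forall t : R, t \in `[0, 1] -> exists c c', local_lift g t c c'.

(* The component of [v] orthogonal, for the real inner product Re<.,.>, to the
   tangent line R (i psi) at [psi] of the fibre of [pi2]. *)
Definition horizontal (psi : sphere) (v : H) : H :=
  let w : H := 'i *: (psi : H) in
  v - (complex.Re (inner w v))%:C *: w.

(* The Fubini-Study norm of the velocity of [g] at [t]: since [pi2] is a
   Riemannian submersion, it is the norm of the horizontal component of the
   velocity of any local lift of [g]. Two local lifts differ by a C^1 phase, so
   this norm is the same for all of them. *)
Definition cp_speed (g : R -> cp) (t : R) : R :=
  get [set l | exists c c',
    local_lift g t c c' /\ l = rnorm (horizontal (c t) (c' t))].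

Definition cp_length (g : R -> cp) : R :=
  \int[lebesgue_measure]_(t in `[0, 1]) cp_speed g t.

Definition cp_dist (x y : cp) : R :=
  inf [set l | exists g : R -> cp,
    [/\ C1_curve g, g 0 = x, g 1 = y & l = cp_length g]].

Definition cp_dist_set (x : cp) (Y : set cp) : R :=
  inf [set cp_dist x y | y in Y].

(* Pj(x | S): the point of [S] nearest to [x]; the default value [x] is
   irrelevant when such a point exists. *)
Definition cp_proj (x : cp) (S : set cp) : cp :=
  xget x [set y | S y /\ cp_dist x y = cp_dist_set x S].

Record event := Event {
  event_op :> {linear H -> H};
  event_bounded : exists M : R, forall v, rnorm (event_op v) <= M * rnorm v;
  event_idem : forall v, event_op (event_op v) = event_op v;
  event_selfadj : forall v w,
    inner (event_op v) w = inner v (event_op w)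
}.

(* pi' (E) = pi3 ((Ran E)^x) *)
Definition event_proj (E : event) : set cp :=
  pi3 @` [set v : nonzero | range E (v : H)].

Definition event_prob (psi : sphere) (E F : event) : R :=
  rnorm (F (E (psi : H))) ^+ 2.

End ProjectiveSpace.

Definition dim_ge2 (R : realType) (H : hilbertType R) : Prop :=
  exists u v : H, forall a b : R[i], a *: u + b *: v = 0 -> a = 0 /\ b = 0.

(* Main.v *)
Require Import Defs.
From mathcomp Require Import all_boot all_order all_algebra.
From mathcomp Require Import all_classical all_reals all_analysis.
From mathcomp Require Import complex ring lra.

(* The point is that the distance defined as an infimum of lengths is
   d(x, y) = angle x y := acos |<x, y>|.

   Lower bound. The angle satisfies the triangle inequality, and for a curve g
   with a local lift c the quotient sin (angle (g t) (g s)) / |s - t| tends to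
   the norm of the horizontal part of c' t as s -> t. Hence the speed of g does
   not depend on the lift, is continuous, and bounds the growth rate of the
   angle; a supremum argument on [0, 1] gives
   angle (g 0) (g t) <= \int_0^t speed + e t for all e > 0.

   Upper bound. If psi and phi are unit representatives with <psi, phi> = cos th
   real and nonnegative, the great circle arc from psi to phi is horizontal with
   constant speed th.

   Then |<psi, phi>| = |<E psi, phi>| <= ||E psi|| for a unit vector phi in the
   range of E, with equality only on the line of E psi. So
   cos (d(x, S)) = ||E psi||, the nearest point of S is the class of E psi, and
   the formula is ||F E psi|| = ||F (E psi / ||E psi||)|| ||E psi||. *)

Import Order.TTheory GRing.Theory Num.Theory.
Import numFieldNormedType.Exports.
Import Normc.

Local Open Scope classical_set_scope.
Local Open Scope ring_scope.

(** * Real and complex inner products, Pythagoras and Cauchy-Schwarz *)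

Section InnerProduct.
#[local] Set Implicit Arguments.
#[local] Unset Strict Implicit.
Context {R : realType} {H : hilbertType R}.
Local Open Scope complex_scope.
Implicit Types (u v w : H) (a : R) (z : R[i]).

Definition rinner u v : R := complex.Re (inner u v).

Lemma normc_norm z : complex.Re `|z| = normc z. Proof. by []. Qed.

Lemma normCE z : `|z| = (normc z)%:C. Proof. by []. Qed.

Lemma normc_ge0 z : 0 <= normc z.
Proof. by rewrite -ler0c -normCE normr_ge0. Qed.

Lemma normc_real a : normc a%:C = `|a|.
Proof. by rewrite /= expr0n addr0 sqrtr_sqr. Qed.

Lemma sqr_normcE z : normc z ^+ 2 = complex.Re z ^+ 2 + complex.Im z ^+ 2.
Proof. by case: z => x y /=; rewrite sqr_sqrtr// addr_ge0// sqr_ge0. Qed.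

Lemma mulcJE z : z^*%C * z = (normc z ^+ 2)%:C.
Proof.
rewrite sqr_normcE; case: z => x y /=; apply/eqP.
by rewrite eq_complex/=; apply/andP; split; apply/eqP; ring.
Qed.

Lemma rnormE v : `|v| = (rnorm v)%:C.
Proof. by rewrite /rnorm RRe_real// normr_real. Qed.

Lemma rnorm_ge0 v : 0 <= rnorm v.
Proof. by rewrite -ler0c -rnormE. Qed.

Lemma rnorm0 : rnorm (0 : H) = 0.
Proof. by rewrite /rnorm normr0. Qed.

Lemma rnorm_eq0 v : (rnorm v == 0) = (v == 0).
Proof. by rewrite -[RHS]normr_eq0 rnormE eq_complex/= eqxx andbT. Qed.

Lemma rnormZ z v : rnorm (z *: v) = normc z * rnorm v.
Proof. by apply: complexI; rewrite -rnormE normrZ normCE rnormE -rmorphM. Qed.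

Lemma rnormD u v : rnorm (u + v) <= rnorm u + rnorm v.
Proof. by rewrite -lecR rmorphD/= -!rnormE ler_normD. Qed.

Lemma sphere_norm (c : sphere H) : rnorm (c : H) = 1.
Proof. by case: c => c /= /eqP c1; rewrite /rnorm c1. Qed.

Lemma inner0r u : inner u 0 = 0 :> R[i].
Proof. by rewrite -(scale0r 0) innerZr mul0r. Qed.

Lemma innerNr u v : inner u (- v) = - inner u v :> R[i].
Proof. by rewrite -scaleN1r innerZr mulN1r. Qed.

Lemma innerBr u v w : inner u (v - w) = inner u v - inner u w :> R[i].
Proof. by rewrite innerDr innerNr. Qed.

Lemma innerDl u v w : inner (u + v) w = inner u w + inner v w :> R[i].
Proof. by rewrite inner_conj innerDr rmorphD/= -!inner_conj. Qed.

Lemma innerZl z u v : inner (z *: u) v = z^*%C * inner u v :> R[i].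
Proof. by rewrite inner_conj innerZr rmorphM/= -inner_conj. Qed.

Lemma innerBl u v w : inner (u - v) w = inner u w - inner v w :> R[i].
Proof. by rewrite inner_conj innerBr rmorphB/= -!inner_conj. Qed.

Lemma inner0l u : inner 0 u = 0 :> R[i].
Proof. by rewrite inner_conj inner0r rmorph0. Qed.

Lemma inner_sqr v : inner v v = (rnorm v ^+ 2)%:C :> R[i].
Proof. by rewrite inner_norm rnormE -rmorphXn. Qed.

Lemma rinnerC u v : rinner u v = rinner v u.
Proof. by rewrite /rinner inner_conj; case: (inner v u). Qed.

Lemma rinnerDr u v w : rinner u (v + w) = rinner u v + rinner u w.
Proof. by rewrite /rinner innerDr raddfD. Qed.

Lemma rinnerBr u v w : rinner u (v - w) = rinner u v - rinner u w.
Proof. by rewrite /rinner innerBr raddfB. Qed.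

Lemma rinnerZr a u v : rinner u (a%:C *: v) = a * rinner u v.
Proof. by rewrite /rinner innerZr; case: (inner u v) => x y /=; rewrite mul0r subr0. Qed.

Lemma rinner_sqr v : rinner v v = rnorm v ^+ 2.
Proof. by rewrite /rinner inner_sqr. Qed.

Lemma rinneriE u v : rinner ('i%R *: u) v = complex.Im (inner u v).
Proof.
rewrite /rinner innerZl -complexiE; case: (inner u v) => x y /=.
by rewrite mul0r mulN1r opprK add0r.
Qed.

Lemma sqr_normc_inner u v :
  normc (inner u v) ^+ 2 = rinner u v ^+ 2 + rinner ('i%R *: u) v ^+ 2.
Proof. by rewrite sqr_normcE rinneriE. Qed.

Lemma normc_innerC u v : normc (inner u v) = normc (inner v u) :> R.
Proof. by apply: complexI; rewrite -!normCE inner_conj normcJ. Qed.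

(** Compares two vectors through their components orthogonal to a unit vector. With [v = w] this is
    Pythagoras; with [v] and [w] distinct it gives the triangle inequality for angles. *)
Lemma inner_orth u v w : rnorm u = 1 ->
  inner (v - inner u v *: u) (w - inner u w *: u) =
  inner v w - (inner u v)^*%C * inner u w :> R[i].
Proof.
move=> u1; rewrite innerBl !innerBr !innerZl !innerZr inner_sqr u1 expr1n.
rewrite [inner v u]inner_conj; ring.
Qed.

Lemma sqr_rnorm_orth u v : rnorm u = 1 ->
  rnorm (v - inner u v *: u) ^+ 2 = rnorm v ^+ 2 - normc (inner u v) ^+ 2.
Proof.
move=> u1; apply: complexI; rewrite -inner_sqr inner_orth// inner_sqr mulcJE.
by rewrite rmorphB.
Qed.

(** After normalizing [u], the defect is the squared norm of the component of [v] orthogonal to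
    it. *)
Lemma normc_inner_le u v : normc (inner u v) <= rnorm u * rnorm v.
Proof.
have [->|u0] := eqVneq u 0; first by rewrite inner0l normc0 rnorm0 mul0r.
have nu : 0 < rnorm u by rewrite lt_neqAle eq_sym rnorm_eq0 u0 rnorm_ge0.
pose e := ((rnorm u)^-1)%:C *: u.
have e1 : rnorm e = 1.
  by rewrite rnormZ normc_real ger0_norm ?invr_ge0 ?ltW// mulVf// gt_eqF.
have uE : u = (rnorm u)%:C *: e.
  by rewrite scalerA -rmorphM/= mulfV ?gt_eqF// scale1r.
rewrite {1}uE innerZl normcM conjc_real normc_real gtr0_norm// ler_pM2l//.
rewrite -(@ler_pXn2r _ 2)// ?nnegrE ?normc_ge0 ?rnorm_ge0//.
by rewrite -subr_ge0 -sqr_rnorm_orth// sqr_ge0.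
Qed.

Lemma rinner_le u v : `|rinner u v| <= rnorm u * rnorm v.
Proof.
apply: le_trans (normc_inner_le u v).
by rewrite -lecR -normCE; apply: le_trans (normc_ge_Re _) _.
Qed.

End InnerProduct.

(** * The angle on CP(H) and its triangle inequality *)

Section Angle.
Local Open Scope quotient_scope.
#[local] Set Implicit Arguments.
#[local] Unset Strict Implicit.
Context {R : realType} {H : hilbertType R}.
Local Open Scope complex_scope.
Implicit Types (x y z : cp H) (psi phi : sphere H).

Lemma pi2_eqP psi phi :
  pi2 psi = pi2 phi <-> exists u : R[i], `|u| = 1 /\ phi = u *: (psi : H) :> H.
Proof. by split => [/eqquotP/asboolP//|h]; apply/eqquotP/asboolP. Qed.

Lemma pi2_repr x : pi2 (repr x) = x.
Proof. exact: reprK. Qed.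

Lemma cp_absinner_pi2 psi phi :
  cp_absinner (pi2 psi) (pi2 phi) = normc (inner (psi : H) (phi : H)).
Proof.
rewrite /cp_absinner normc_norm.
have [u [u1 ->]] := (pi2_eqP (repr (pi2 psi)) psi).1 (pi2_repr _).
have [v [v1 ->]] := (pi2_eqP (repr (pi2 phi)) phi).1 (pi2_repr _).
rewrite innerZl innerZr !normcM.
have -> : normc u^*%C = 1 by apply: complexI; rewrite -normCE normcJ.
have -> : normc v = 1 by apply: complexI; rewrite -normCE.
by rewrite !mul1r.
Qed.

Lemma cp_absinner_ge0 x y : 0 <= cp_absinner x y.
Proof. exact: normc_ge0. Qed.

Lemma cp_absinner_le1 x y : cp_absinner x y <= 1.
Proof. by rewrite (le_trans (normc_inner_le _ _))// !sphere_norm mulr1. Qed.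

Lemma cp_absinnerC x y : cp_absinner x y = cp_absinner y x.
Proof. exact: normc_innerC. Qed.

Lemma cp_absinner_refl x : cp_absinner x x = 1.
Proof.
by rewrite /cp_absinner normc_norm inner_sqr normc_real sphere_norm expr1n normr1.
Qed.

Definition angle x y : R := acos (cp_absinner x y).

Lemma cp_absinner_itv x y : -1 <= cp_absinner x y <= 1.
Proof. by rewrite cp_absinner_le1 andbT (le_trans _ (cp_absinner_ge0 x y))// lerN10. Qed.

Lemma cos_angle x y : cos (angle x y) = cp_absinner x y.
Proof. by rewrite acosK// in_itv/= cp_absinner_itv. Qed.

Lemma sin_angle x y : sin (angle x y) = Num.sqrt (1 - cp_absinner x y ^+ 2).
Proof. by rewrite sin_acos// cp_absinner_itv. Qed.

Lemma angle_ge0 x y : 0 <= angle x y.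
Proof. by rewrite acos_ge0// cp_absinner_itv. Qed.

Lemma angle_lepi x y : angle x y <= pi.
Proof. by rewrite acos_lepi// cp_absinner_itv. Qed.

Lemma angle_refl x : angle x x = 0.
Proof. by rewrite /angle cp_absinner_refl acos1. Qed.

Lemma angleC x y : angle x y = angle y x.
Proof. by rewrite /angle cp_absinnerC. Qed.

Lemma ler_acos (a b : R) : 0 <= a -> a <= b -> b <= 1 -> acos b <= acos a.
Proof.
move=> a0 ab b1; have b0 := le_trans a0 ab; have a1 := le_trans ab b1.
have a' : -1 <= a <= 1 by rewrite a1 andbT (le_trans _ a0)// lerN10.
have b' : -1 <= b <= 1 by rewrite b1 andbT (le_trans _ b0)// lerN10.
rewrite leNgt -ltr_cos ?in_itv/= ?acos_ge0 ?acos_lepi//.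
by rewrite !acosK ?in_itv//= -leNgt.
Qed.

Lemma angle_le_pihalf x y : angle x y <= pi / 2.
Proof. by rewrite -acos0 ler_acos ?cp_absinner_ge0 ?cp_absinner_le1. Qed.

(** As cos decreases on [0, pi], it suffices to bound the cosine of the sum by |<a, c>|. Splitting
    [a] and [c] along [b] gives <a, c> = <a, b><b, c> + <a', c'>, where [a'] and [c'] have the sines
    as norms, and Cauchy-Schwarz bounds the last term. *)
Lemma angle_triangle x y z : angle x z <= angle x y + angle y z.
Proof.
have sum_lepi : angle x y + angle y z <= pi.
  by have := angle_le_pihalf x y; have := angle_le_pihalf y z; lra.
have sum_ge0 : 0 <= angle x y + angle y z by rewrite addr_ge0 ?angle_ge0.
rewrite leNgt -ltr_cos ?in_itv/= ?angle_ge0 ?angle_lepi ?sum_ge0//.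
rewrite -leNgt cosD !cos_angle !sin_angle.
rewrite -[x]pi2_repr -[y]pi2_repr -[z]pi2_repr !cp_absinner_pi2.
set a := repr x; set b := repr y; set c := repr z.
pose a' : H := (a : H) - inner (b : H) (a : H) *: (b : H).
pose c' : H := (c : H) - inner (b : H) (c : H) *: (b : H).
have rnorm_proj (d : sphere H) :
    rnorm ((d : H) - inner (b : H) (d : H) *: (b : H)) =
    Num.sqrt (1 - normc (inner (b : H) (d : H)) ^+ 2).
  rewrite -[LHS]ger0_norm ?rnorm_ge0// -sqrtr_sqr sqr_rnorm_orth ?sphere_norm//.
  by rewrite expr1n.
have CS : normc (inner a' c') <= rnorm a' * rnorm c' := normc_inner_le _ _.
have := inner_orth (a : H) (c : H) (sphere_norm b); rewrite -/a' -/c' => E.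
have : normc (inner (a : H) (b : H)) * normc (inner (b : H) (c : H)) <=
    normc (inner (a : H) (c : H)) + normc (inner a' c').
  rewrite -(normcN (inner a' c')) [inner (a : H) (b : H)]inner_conj -normcM.
  apply: le_trans (le_normcD _ _).
  by rewrite E opprB addrC subrK.
move: CS; rewrite /a' /c' !rnorm_proj (normc_innerC (b : H) (a : H)); lra.
Qed.

End Angle.

(** * Limits in H, and limits restricted to [0, 1] *)

Section Limits.
#[local] Set Implicit Arguments.
#[local] Unset Strict Implicit.
Context {R : realType} {H : hilbertType R}.
Local Open Scope complex_scope.

Lemma cvg_rnormP {T : Type} {F : set_system T} {FF : Filter F} (f : T -> H) (l : H) :
  f x @[x --> F] --> l <-> rnorm (f x - l) @[x --> F] --> (0 : R).
Proof.
split=> [/cvgrPdist_lt fl|/cvgrPdist_lt fl]; apply/cvgrPdist_lt => e e0.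
  have e0' : 0 < e%:C by rewrite ltcR.
  apply: filterS (fl _ e0') => x.
  by rewrite distrC rnormE ltcR sub0r normrN ger0_norm ?rnorm_ge0.
(* A positive element of [R[i]] has zero imaginary part, so the radius is real. *)
move: e0; case: e => e b; rewrite ltcE/= => /andP[/eqP -> e0].
apply: filterS (fl _ e0) => x.
rewrite sub0r normrN ger0_norm ?rnorm_ge0// => h.
by rewrite distrC rnormE ltcR.
Qed.

Lemma cvg_rinner {T : Type} {F : set_system T} {FF : Filter F} (f g : T -> H) (u v : H) :
  f x @[x --> F] --> u -> g x @[x --> F] --> v ->
  rinner (f x) (g x) @[x --> F] --> rinner u v.
Proof.
move=> /cvg_rnormP fu /cvg_rnormP gv.
apply/subr_cvg0/norm_cvg0P.
pose m x : R := rnorm (f x - u) * (rnorm v + rnorm (g x - v)) + rnorm u * rnorm (g x - v).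
apply: (@squeeze_cvgr _ _ _ _ (cst 0) m).
- apply: nearW => x; rewrite normr_ge0/=.
  have -> : rinner (f x) (g x) - rinner u v =
      rinner (f x - u) (v + (g x - v)) + rinner u (g x - v).
    rewrite [v + _]addrC subrK rinnerBr !(rinnerC _ (g x)) rinnerBr; ring.
  apply: le_trans (ler_normD _ _) _; apply: lerD; last exact: rinner_le.
  apply: le_trans (rinner_le _ _) _; apply: ler_wpM2l (rnormD _ _).
  exact: rnorm_ge0.
- exact: cvg_cst.
- have -> : (0 : R) = 0 * (rnorm v + 0) + rnorm u * 0 by rewrite mul0r mulr0 add0r.
  apply: cvgD; apply: cvgM => //; first by apply: cvgD => //; exact: cvg_cst.
  exact: cvg_cst.
Qed.

Lemma cvg_sqr {T : Type} {F : set_system T} {FF : Filter F} (f : T -> R) (a : R) :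
  f x @[x --> F] --> a -> f x ^+ 2 @[x --> F] --> a ^+ 2.
Proof.
by move=> fa; rewrite expr2; under eq_fun do rewrite expr2; exact: cvgM.
Qed.

Lemma cvg_sqrt {T : Type} {F : set_system T} {FF : Filter F} (f : T -> R) (a : R) :
  f x @[x --> F] --> a -> Num.sqrt (f x) @[x --> F] --> Num.sqrt a.
Proof. exact: (continuous_cvg _ (@sqrt_continuous R _)). Qed.

Lemma cvg_rnorm_sqr {T : Type} {F : set_system T} {FF : Filter F} (f : T -> H) (u : H) :
  f x @[x --> F] --> u -> rnorm (f x) ^+ 2 @[x --> F] --> rnorm u ^+ 2.
Proof.
move=> fu; rewrite -rinner_sqr.
under eq_fun do rewrite -rinner_sqr.
exact: cvg_rinner.
Qed.

Lemma cvg_scale {T : Type} {F : set_system T} {FF : Filter F} (k : R[i]) (f : T -> H) (u : H) :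
  f x @[x --> F] --> u -> k *: f x @[x --> F] --> k *: u.
Proof.
move=> /cvg_rnormP fu; apply/cvg_rnormP.
under eq_fun do rewrite -scalerBr rnormZ.
by rewrite -(mulr0 (normc k)); apply: cvgM => //; exact: cvg_cst.
Qed.

(** Needed for uniqueness of limits. A step of length at most 1/2, to the right if t <= 1/2 and to
    the left otherwise, stays in [0, 1]. *)
Lemma itv01_dnbhs_proper (t : R) : t \in `[0, 1] -> ProperFilter (within `[0, 1] t^').
Proof.
rewrite in_itv/= => /andP[t0 t1]; apply: Build_ProperFilter => -[e /= e0 he].
pose d := Num.min (e / 2) (1 / 2).
have d0 : 0 < d by rewrite lt_min !divr_gt0.
have de : d < e by rewrite gt_min; apply/orP; left; lra.
have d1 : d <= 1 / 2 by rewrite ge_min lexx orbT.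
have [t2|t2] := leP t (1 / 2).
  apply: (he (t + d)) => /=.
  - by rewrite opprD addrA subrr sub0r normrN gtr0_norm.
  - by apply/eqP; lra.
  - by rewrite in_itv/=; lra.
apply: (he (t - d)) => /=.
- by rewrite opprB addrC subrK gtr0_norm.
- by apply/eqP; lra.
- by rewrite in_itv/=; lra.
Qed.

Lemma within_dnbhs (t : R) (D P : set R) :
  within D (nbhs t) P -> within D t^' P.
Proof. by rewrite /within/= /dnbhs /within /=; apply: filterS => s Ps _. Qed.

Lemma within_dnbhs_neq (t : R) (D : set R) : \forall s \near within D t^', s != t.
Proof. by apply: (@filterE _ (nbhs t)). Qed.

Lemma dnbhs_within_cvg {T : topologicalType} (t : R) (D : set R) (f : R -> T) :
  f s @[s --> within D t^'] --> f t -> f s @[s --> within D (nbhs t)] --> f t.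
Proof.
move=> ft P Pt.
have ftP : nbhs t [set s | s != t -> D s -> P (f s)] := ft P Pt.
suff : nbhs t [set s | D s -> P (f s)] by [].
apply: filterS ftP => s h Ds; have [->|st] := eqVneq s t; last exact: h.
exact: nbhs_singleton Pt.
Qed.

Lemma has_deriv_cvg_dnbhs (c : R -> H) (t : R) (v : H) :
  has_deriv c t v -> c s @[s --> within `[0, 1] t^'] --> c t.
Proof.
move=> cv; apply/cvg_rnormP.
pose w s := ((s - t)^-1)%:C *: (c s - c t).
have wv : w s @[s --> within `[0, 1] t^'] --> v by [].
have /cvg_rnormP wv0 := wv.
have ht : s - t @[s --> within `[0, 1] t^'] --> (0 : R).
  apply/subr_cvg0; apply: cvg_within_filter.
  exact: cvg_within_filter.
have m0 : `|s - t| * (rnorm v + rnorm (w s - v)) @[s --> within `[0, 1] t^'] --> (0 : R).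
  have : `|s - t| * (rnorm v + rnorm (w s - v)) @[s --> within `[0, 1] t^']
      --> 0 * (rnorm v + 0).
    apply: cvgM; first exact/norm_cvg0P.
    by apply: cvgD => //; exact: cvg_cst.
  by rewrite mul0r.
apply: (squeeze_cvgr _ (cvg_cst _) m0); apply: within_dnbhs.
apply: nearW => s _; rewrite rnorm_ge0/=.
have [->|st] := eqVneq s t; first by rewrite !subrr rnorm0 normr0 mul0r.
have -> : c s - c t = (s - t)%:C *: w s.
  by rewrite scalerA -rmorphM/= mulfV ?subr_eq0// scale1r.
rewrite rnormZ normc_real ler_wpM2l//.
by rewrite -{1}(subrK v (w s)) addrC rnormD.
Qed.

Lemma has_deriv_cvg (c : R -> H) (t : R) (v : H) :
  has_deriv c t v -> c s @[s --> within `[0, 1] (nbhs t)] --> c t.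
Proof. by move=> /has_deriv_cvg_dnbhs; exact: dnbhs_within_cvg. Qed.

(** Pythagoras for the real inner product and the unit vector ['i *: psi]. *)
Lemma rnorm_horizontal (psi : sphere H) (v : H) :
  rnorm (horizontal psi v) =
  Num.sqrt (rnorm v ^+ 2 - rinner ('i%R *: (psi : H)) v ^+ 2).
Proof.
rewrite -[LHS]ger0_norm ?rnorm_ge0// -sqrtr_sqr.
set w := 'i%R *: (psi : H).
have ww : rinner w w = 1.
  by rewrite rinner_sqr rnormZ sphere_norm -complexiE /= expr0n expr1n add0r sqrtr1 mulr1 expr1n.
congr Num.sqrt; rewrite /horizontal -/w -/(rinner w v).
rewrite -!rinner_sqr rinnerBr rinnerZr !(rinnerC (v - _)) !rinnerBr !rinnerZr ww.
by rewrite (rinnerC v w); ring.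
Qed.

End Limits.

(** * The Fubini-Study speed as the growth rate of the angle *)

Section Speed.
#[local] Set Implicit Arguments.
#[local] Unset Strict Implicit.
Context {R : realType} {H : hilbertType R}.
Local Open Scope complex_scope.
Implicit Types (g : R -> cp H) (t : R).

Lemma local_lift_at g t (c : R -> sphere H) (c' : R -> H) : t \in `[0, 1] -> local_lift g t c c' ->
  [/\ pi2 (c t) = g t, has_deriv (fun r => c r : H) t (c' t) &
      c' r @[r --> within `[0, 1] (nbhs t)] --> c' t].
Proof.
move=> t01 gl.
have /nbhs_singleton : nbhs t [set s | s \in `[0, 1] -> [/\ pi2 (c s) = g s,
    has_deriv (fun r => c r : H) s (c' s) &
    c' r @[r --> within `[0, 1] (nbhs s)] --> c' s]] := gl.
exact.
Qed.

Lemma local_lift_near g t (c : R -> sphere H) (c' : R -> H) : local_lift g t c c' ->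
  \forall s \near within `[0, 1] (nbhs t), local_lift g s c c'.
Proof.
move=> gl.
have /near_join : nbhs t [set s | s \in `[0, 1] -> [/\ pi2 (c s) = g s,
    has_deriv (fun r => c r : H) s (c' s) &
    c' r @[r --> within `[0, 1] (nbhs s)] --> c' s]] := gl.
by apply: filterS => s gs _.
Qed.

(** An exact expansion, with no remainder to estimate: since [p] and [q] are both unit vectors, the
    real part of <p, q> is 1 - h^2 ||w||^2 / 2, and its imaginary part is [h] times the component of
    [w] along ['i *: p]. *)
Lemma sqr_absinner_chord (p q : sphere H) (h : R) (w : H) :
  h != 0 -> (q : H) = (p : H) + h%:C *: w ->
  1 - normc (inner (p : H) (q : H)) ^+ 2 =
  h ^+ 2 * (rnorm w ^+ 2 - rinner ('i%R *: (p : H)) w ^+ 2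
            - h ^+ 2 * (rnorm w ^+ 2) ^+ 2 / 4).
Proof.
move=> h0 qE; rewrite sqr_normc_inner.
have pp : rinner (p : H) (p : H) = 1 by rewrite rinner_sqr sphere_norm expr1n.
have ip : rinner ('i%R *: (p : H)) (p : H) = 0 by rewrite rinneriE inner_sqr.
have pw : rinner (p : H) w = - h * rnorm w ^+ 2 / 2.
  have : rinner (q : H) (q : H) = 1 by rewrite rinner_sqr sphere_norm expr1n.
  rewrite {1 2}qE rinnerDr rinnerZr !(rinnerC (_ + _)) !rinnerDr !rinnerZr.
  rewrite (rinnerC w p) pp (rinner_sqr w) => E.
  apply: (mulfI h0); lra.
by rewrite qE !rinnerDr !rinnerZr pp ip pw; field.
Qed.

(* The quotient on the left depends only on [g], hence so does the speed
   computed from a lift. *)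
Lemma sin_angle_lift g t (c : R -> sphere H) (c' : R -> H) : t \in `[0, 1] -> local_lift g t c c' ->
  sin (angle (g t) (g s)) / `|s - t| @[s --> within `[0, 1] t^'] -->
  rnorm (horizontal (c t) (c' t)).
Proof.
move=> t01 gl; have [gt dc _] := local_lift_at t01 gl.
pose w s : H := ((s - t)^-1)%:C *: ((c s : H) - (c t : H)).
have wv : w s @[s --> within `[0, 1] t^'] --> c' t by [].
have ht : s - t @[s --> within `[0, 1] t^'] --> (0 : R).
  apply/subr_cvg0; apply: cvg_within_filter.
  exact: cvg_within_filter.
(* The bracket of [sqr_absinner_chord] for the chord from [c t] to [c s]; its last term vanishes in
   the limit. *)
pose X s := rnorm (w s) ^+ 2 - rinner ('i%R *: (c t : H)) (w s) ^+ 2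
            - (s - t) ^+ 2 * (rnorm (w s) ^+ 2) ^+ 2 / 4.
have Xv : X s @[s --> within `[0, 1] t^'] -->
    rnorm (c' t) ^+ 2 - rinner ('i%R *: (c t : H)) (c' t) ^+ 2
    - 0 ^+ 2 * (rnorm (c' t) ^+ 2) ^+ 2 / 4.
  have wn : rnorm (w s) ^+ 2 @[s --> within `[0, 1] t^'] --> rnorm (c' t) ^+ 2.
    exact: cvg_rnorm_sqr.
  have wr : rinner ('i%R *: (c t : H)) (w s) @[s --> within `[0, 1] t^'] -->
      rinner ('i%R *: (c t : H)) (c' t).
    by apply: cvg_rinner => //; exact: cvg_cst.
  apply: cvgB; first by apply: cvgB; [exact: wn|exact: cvg_sqr].
  apply: cvgM; last exact: cvg_cst.
  apply: cvgM; [exact: cvg_sqr|exact: cvg_sqr].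
rewrite rnorm_horizontal.
rewrite expr0n !mul0r subr0 in Xv.
apply: cvg_trans (cvg_sqrt Xv).
apply: near_eq_cvg.
near=> s.
have st : s != t by near: s; exact: within_dnbhs_neq.
have gs : pi2 (c s) = g s.
  near: s; apply: within_dnbhs.
  by apply: filterS gl => s [].
rewrite sin_angle -gt -gs cp_absinner_pi2.
have st0 : s - t != 0 by rewrite subr_eq0.
rewrite (@sqr_absinner_chord (c t) (c s) (s - t) (w s))//; last first.
  by rewrite scalerA -rmorphM/= mulfV// scale1r addrC subrK.
by rewrite sqrtrM ?sqr_ge0// sqrtr_sqr mulrAC mulfV ?mul1r// normr_eq0.
Unshelve. all: by end_near. Qed.

(** The lift chosen by [get] and the given one both yield the limit of the same quotient, and limits
    are unique. *)
Lemma cp_speedE g t (c : R -> sphere H) (c' : R -> H) : t \in `[0, 1] -> local_lift g t c c' ->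
  cp_speed g t = rnorm (horizontal (c t) (c' t)).
Proof.
move=> t01 gl; rewrite /cp_speed.
case: xgetP => [l _ [d [d' [gd ->]]]|/(_ (rnorm (horizontal (c t) (c' t))))]; last first.
  by case; exists c, c'.
have FF := itv01_dnbhs_proper t01.
exact: (cvg_unique (@Rhausdorff R) (sin_angle_lift t01 gd) (sin_angle_lift t01 gl)).
Qed.

(** One lift around [t] computes the speed at all nearby points, as a continuous function of [c] and
    [c']. *)
Lemma cp_speed_continuous g : C1_curve g -> {within `[0, 1], continuous (cp_speed g)}.
Proof.
move=> gC1; apply/subspace_continuousP => t t01.
have [c [c' gl]] := gC1 t t01.
have [gt dc cc'] := local_lift_at t01 gl.
have r : rinner ('i%R *: (c s : H)) (c' s) @[s --> within `[0, 1] (nbhs t)] -->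
    rinner ('i%R *: (c t : H)) (c' t).
  by apply: cvg_rinner => //; apply: cvg_scale; exact: has_deriv_cvg dc.
have n : rnorm (c' s) ^+ 2 @[s --> within `[0, 1] (nbhs t)] --> rnorm (c' t) ^+ 2.
  exact: cvg_rnorm_sqr.
have nr : rnorm (c' s) ^+ 2 - rinner ('i%R *: (c s : H)) (c' s) ^+ 2
    @[s --> within `[0, 1] (nbhs t)] -->
    rnorm (c' t) ^+ 2 - rinner ('i%R *: (c t : H)) (c' t) ^+ 2.
  by apply: cvgB; [exact: n|exact: cvg_sqr].
suff : cp_speed g s @[s --> within `[0, 1] (nbhs t)] --> cp_speed g t by [].
rewrite (cp_speedE t01 gl) rnorm_horizontal.
apply: cvg_trans (cvg_sqrt nr); apply: near_eq_cvg; near=> s.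
rewrite -rnorm_horizontal; apply/esym/cp_speedE.
  by near: s; exact: withinT.
by near: s; exact: local_lift_near.
Unshelve. all: by end_near. Qed.

(** By the mean value theorem sin x = x cos y with 0 < y < x, and cos decreases. This turns bounds
    on the sine of an angle into bounds on the angle. *)
Lemma mul_cos_le_sin (x : R) : 0 <= x <= pi -> x * cos x <= sin x.
Proof.
move=> /andP[x0 xpi]; have [->|xn0] := eqVneq x 0; first by rewrite mul0r sin0.
have xgt0 : 0 < x by rewrite lt_neqAle eq_sym xn0.
have [|y] := @MVT R sin cos 0 x xgt0.
  by apply: continuous_subspaceT => y; exact: continuous_sin.
rewrite in_itv/= sin0 !subr0 => /andP[y0 yx] ->; rewrite mulrC ler_pM2r//.
by rewrite ltW// ltr_cos ?in_itv/= ?x0 ?(ltW y0) ?(le_trans (ltW yx))// ltW.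
Qed.

(** The sine of the angle over |s - t| tends to the speed and the cosine tends to 1, so the tangent
    over |s - t| has the same limit; the angle is at most its tangent. *)
Lemma angle_le_speed g t (e : R) : C1_curve g -> t \in `[0, 1] -> 0 < e ->
  \forall s \near within `[0, 1] (nbhs t),
    angle (g t) (g s) <= (cp_speed g t + e) * `|s - t|.
Proof.
move=> gC1 t01 e0; have [c [c' gl]] := gC1 t t01.
have q := sin_angle_lift t01 gl; rewrite -(cp_speedE t01 gl) in q.
have ht : `|s - t| @[s --> within `[0, 1] t^'] --> (0 : R).
  apply/norm_cvg0P/subr_cvg0; apply: cvg_within_filter.
  exact: cvg_within_filter.
have sin0 : sin (angle (g t) (g s)) @[s --> within `[0, 1] t^'] --> (0 : R).
  have : sin (angle (g t) (g s)) / `|s - t| * `|s - t| @[s --> within `[0, 1] t^']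
      --> cp_speed g t * 0 by apply: cvgM.
  rewrite mulr0; apply: cvg_trans.
  apply: near_eq_cvg; near=> s.
  have st : s != t by near: s; exact: within_dnbhs_neq.
  by rewrite mulfVK// normr_eq0 subr_eq0.
have cos1 : cos (angle (g t) (g s)) @[s --> within `[0, 1] t^'] --> (1 : R).
  have : Num.sqrt (1 - sin (angle (g t) (g s)) ^+ 2) @[s --> within `[0, 1] t^']
      --> Num.sqrt (1 - 0 ^+ 2).
    apply: cvg_sqrt.
    by apply: cvgB; [exact: cvg_cst|exact: cvg_sqr sin0].
  rewrite expr0n/= subr0 sqrtr1; apply: cvg_trans.
  apply: near_eq_cvg; apply: nearW => s.
  by rewrite -cos2sin2 sqrtr_sqr ger0_norm// cos_angle cp_absinner_ge0.
have tan0 : sin (angle (g t) (g s)) / `|s - t| * (cos (angle (g t) (g s)))^-1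
    @[s --> within `[0, 1] t^'] --> cp_speed g t * 1^-1.
  by apply: cvgM => //; apply: cvgV => //; exact: oner_neq0.
rewrite invr1 mulr1 in tan0.
have : \forall s \near within `[0, 1] t^', angle (g t) (g s) <= (cp_speed g t + e) * `|s - t|.
  near=> s.
  have st : s != t by near: s; exact: within_dnbhs_neq.
  have c0 : 0 < cos (angle (g t) (g s)) by near: s; exact: cvgr_gt cos1 _ ltr01.
  have st0 : 0 < `|s - t| by rewrite normr_gt0 subr_eq0.
  have : sin (angle (g t) (g s)) / `|s - t| * (cos (angle (g t) (g s)))^-1 < cp_speed g t + e.
    by near: s; apply: cvgr_lt tan0 _ _; rewrite ltrDl.
  rewrite ltr_pdivrMr// ltr_pdivrMr// => hs.
  have := @mul_cos_le_sin (angle (g t) (g s)); rewrite angle_ge0 angle_lepi => /(_ isT) hc.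
  rewrite -(ler_pM2r c0) (le_trans hc)// (le_trans (ltW hs))//.
  by rewrite mulrAC.
move=> near_t.
(* The punctured neighbourhood is completed by [s = t], where both sides vanish. *)
have near_t' : nbhs t [set s | s != t -> s \in `[0, 1] ->
    angle (g t) (g s) <= (cp_speed g t + e) * `|s - t|] := near_t.
suff : nbhs t [set s | s \in `[0, 1] ->
    angle (g t) (g s) <= (cp_speed g t + e) * `|s - t|] by [].
apply: filterS near_t' => s h s01; have [->|st] := eqVneq s t; last exact: h.
by rewrite angle_refl subrr normr0 mulr0.
Unshelve. all: by end_near. Qed.

End Speed.

(** * Every C^1 curve is at least as long as the angle between its end points *)

Section LowerBound.
#[local] Set Implicit Arguments.
#[local] Unset Strict Implicit.
Context {R : realType} {H : hilbertType R}.
Local Notation mu := (@lebesgue_measure R).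

(** The difference is the integral over ]a, b], compared with that of the constant [k]. It bounds
    the growth of the length function without differentiating it. *)
Lemma le_increment_Rintegral (f : R -> R) (k a b : R) :
  mu.-integrable `[0, 1] (EFin \o f) -> 0 <= a -> a < b -> b <= 1 ->
  (forall u, u \in `[a, b] -> k <= f u) ->
  k * (b - a) <= \int[mu]_(t in `[0, b]) f t - \int[mu]_(t in `[0, a]) f t.
Proof.
move=> fi a0 ab b1 fk.
have fi' (l : itv_bound R) : (BLeft 0 <= l)%O ->
    mu.-integrable [set` Interval l (BRight b)] (EFin \o f).
  move=> hl; apply: integrableS fi => //.
  by apply: subset_itv => //; rewrite bnd_simp.
rewrite Rintegral_itvB ?fi' ?bnd_simp//; last exact: ltW.
have muE : mu `]a, b] = (b - a)%:E by rewrite lebesgue_measure_itv/= lte_fin ab -EFinB.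
have -> : k * (b - a) = \int[mu]_(t in `]a, b]) cst k t.
  by rewrite Rintegral_cst//; congr (_ * _); rewrite [RHS](congr1 fine muE).
apply: le_Rintegral => //.
- have ci : mu.-integrable `[0, 1] (EFin \o cst k).
    apply: continuous_compact_integrable; first exact: segment_compact.
    by apply: continuous_subspaceT => u; exact: cvg_cst.
  apply: integrableS ci => //.
  by apply: subset_itv => //; rewrite bnd_simp.
- by apply: fi'; rewrite bnd_simp.
- move=> u /=; rewrite in_itv/= => /andP[au ub].
  by rewrite fk// in_itv/= ub ltW.
Qed.

Lemma cp_length_ge_angle (g : R -> cp H) : C1_curve g -> angle (g 0) (g 1) <= cp_length g.
Proof.
move=> gC1; rewrite /cp_length.
have fc := cp_speed_continuous gC1.
have fi : mu.-integrable `[0, 1] (EFin \o cp_speed g).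
  by apply: continuous_compact_integrable => //; exact: segment_compact.
pose L t := \int[mu]_(s in `[0, t]) cp_speed g s.
apply/ler_addgt0Pr => e e0.
(* Near [m] the angle grows at rate at most speed + e/2, while [L] grows at rate at least speed -
   e/2; the gap is [e] per unit of time. *)
have step m : m \in `[0, 1] -> exists2 d : R, 0 < d & forall s, s \in `[0, 1] ->
    `|m - s| < d ->
    (s <= m -> angle (g s) (g m) <= L m - L s + e * (m - s)) /\
    (m <= s -> angle (g m) (g s) <= L s - L m + e * (s - m)).
  move=> m01; have e2 : 0 < e / 2 by rewrite divr_gt0.
  have near_f : \forall s \near within `[0, 1] (nbhs m), cp_speed g m - e / 2 < cp_speed g s.
    have fm := (@subspace_continuousP _ _ _ _).1 fc m m01.
    by apply: (cvgr_gt _ fm); rewrite ltrBlDr ltrDl.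
  have [d /= d0 hd] : nbhs m [set s | s \in `[0, 1] ->
      angle (g m) (g s) <= (cp_speed g m + e / 2) * `|s - m| /\
      cp_speed g m - e / 2 < cp_speed g s].
    have h1 : nbhs m [set s | s \in `[0, 1] ->
        angle (g m) (g s) <= (cp_speed g m + e / 2) * `|s - m|] :=
      angle_le_speed gC1 m01 e2.
    have h2 : nbhs m [set s | s \in `[0, 1] ->
      cp_speed g m - e / 2 < cp_speed g s] := near_f.
    by apply: filterS2 h1 h2 => s h1 h2 s01; split; [exact: h1|exact: h2].
  exists d => // s s01 smd; have [hs _] := hd s smd s01.
  move: (m01) (s01); rewrite !in_itv/= => /andP[m0 m1] /andP[s0 s1].
  have [->|sm] := eqVneq s m; first by rewrite angle_refl !subrr mulr0 addr0.
  split=> le.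
    have {}le : s < m by rewrite lt_neqAle sm.
    have := @le_increment_Rintegral _ (cp_speed g m - e / 2) s m fi s0 le m1.
    rewrite -/(L m) -/(L s) angleC => hL.
    have {}hL : (cp_speed g m - e / 2) * (m - s) <= L m - L s.
      apply: hL => u; rewrite in_itv/= => /andP[su um]; have [||_ /ltW//] := hd u.
        rewrite /= ger0_norm ?subr_ge0//; move: smd; rewrite ger0_norm ?subr_ge0 ?ltW//; lra.
      by rewrite in_itv/=; lra.
    by move: hs; rewrite distrC gtr0_norm ?subr_gt0//; lra.
  have {}le : m < s by rewrite lt_neqAle eq_sym sm.
  have := @le_increment_Rintegral _ (cp_speed g m - e / 2) m s fi m0 le s1.
  rewrite -/(L m) -/(L s) => hL.
  have {}hL : (cp_speed g m - e / 2) * (s - m) <= L s - L m.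
    apply: hL => u; rewrite in_itv/= => /andP[mu' us]; have [||_ /ltW//] := hd u.
      rewrite /= distrC ger0_norm ?subr_ge0//; move: smd; rewrite distrC ger0_norm ?subr_ge0 ?ltW//; lra.
    by rewrite in_itv/=; lra.
  by move: hs; rewrite gtr0_norm ?subr_gt0//; lra.
(* Continuous induction: the supremum of [A] belongs to [A] and cannot be less than 1. *)
pose A := [set t | t \in `[0, 1] /\ angle (g 0) (g t) <= L t + e * t].
have L0 : L 0 = 0 by rewrite /L set_itv1 Rintegral_set1.
have A0 : A 0 by split; rewrite ?in_itv/= ?lexx ?ler01// angle_refl L0 mulr0 addr0.
have supA : has_sup A.
  by split; [exists 0|exists 1 => t [+ _]; rewrite in_itv/= => /andP[]].
pose m := sup A.
have m01 : m \in `[0, 1].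
  rewrite in_itv/= sup_upper_bound//=; apply: ge_sup; first by exists 0.
  by move=> t [+ _]; rewrite in_itv/= => /andP[].
have [d d0 hd] := step m m01.
(* A point of [A] within [d] below the supremum is joined to it by the local estimate and the
   triangle inequality. *)
have Am : A m.
  split => //; have [s [s01 sA] sm] := sup_adherent d0 supA.
  have sm' : s <= m by apply: sup_upper_bound.
  have [|h _] := hd s s01; first by rewrite ger0_norm ?subr_ge0// -/m; rewrite -/m in sm; lra.
  by have := angle_triangle (g 0) (g s) (g m); have := h sm'; lra.
have [m0 m1] : 0 <= m /\ m <= 1 by move: m01; rewrite in_itv/= => /andP[].
have m1E : m = 1.
  apply/eqP; rewrite eq_le m1/= leNgt; apply/negP => ml1.
  (* A point beyond [m], within reach of the local estimate and still in [0, 1]; it lies in [A],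
     against the choice of [m]. *)
  pose s := m + Num.min (d / 2) (1 - m).
  have k0 : 0 < Num.min (d / 2) (1 - m) by rewrite lt_min divr_gt0//= subr_gt0.
  have k1 : Num.min (d / 2) (1 - m) <= 1 - m by rewrite ge_min lexx orbT.
  have kd : Num.min (d / 2) (1 - m) < d by rewrite gt_min; apply/orP; left; lra.
  have s01 : s \in `[0, 1] by rewrite in_itv/= /s; lra.
  have [|_ h] := hd s s01; first by rewrite /s opprD addrA subrr sub0r normrN gtr0_norm.
  have ms : m <= s by rewrite /s; lra.
  have : A s.
    split => //; have := angle_triangle (g 0) (g m) (g s); have := h ms.
    by case: Am; lra.
  by move=> /(sup_upper_bound supA); rewrite -/m /s; lra.
by case: Am => _; rewrite m1E mulr1.
Qed.

End LowerBound.

(** * Great circle arcs, and the distance as an angle *)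

Section Geodesic.
#[local] Set Implicit Arguments.
#[local] Unset Strict Implicit.
Context {R : realType} {H : hilbertType R}.
Local Open Scope complex_scope.
Local Notation mu := (@lebesgue_measure R).

Lemma is_derive_quotient (f : R -> R) (t df : R) : is_derive t 1 f df ->
  (s - t)^-1 * (f s - f t) @[s --> t^'] --> df.
Proof.
move=> fd; have fc : h^-1 *: (f (h *: 1 + t) - f t) @[h --> 0^'] --> df.
  by have [fd' <-] := fd; exact: fd'.
apply/cvgrPdist_lt => e e0; have [d /= d0 hd] := (@cvgrPdist_lt _ _ _ _ _ _ _).1 fc e e0.
exists d => //= s sd st.
have := hd (s - t); rewrite /= sub0r normrN distrC => /(_ sd).
by rewrite subr_eq0 => /(_ st); rewrite /GRing.scale/= mulr1 subrK.
Qed.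

Lemma cvg_scalel {T : Type} {F : set_system T} {FF : Filter F} (q : T -> R) (a : R) (v : H) :
  q x @[x --> F] --> a -> (q x)%:C *: v @[x --> F] --> a%:C *: v.
Proof.
move=> qa; apply/cvg_rnormP.
under eq_fun do rewrite -scalerBl -rmorphB/= rnormZ normc_real.
have : `|q x - a| * rnorm v @[x --> F] --> 0 * rnorm v.
  by apply: cvgM; [exact/norm_cvg0P/subr_cvg0|exact: cvg_cst].
by rewrite mul0r.
Qed.

(** Multiplying any unit representative of [y] by the phase |z| / z makes its inner product with
    [psi] real and nonnegative. *)
Lemma aligned_repr (psi : sphere H) (y : cp H) : exists phi : sphere H,
  pi2 phi = y /\ inner (psi : H) (phi : H) = (cos (angle (pi2 psi) y))%:C.
Proof.
pose z := inner (psi : H) (repr y : H).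
have [u u1 uz] : exists2 u : R[i], `|u| = 1 & u * z = (normc z)%:C.
  have [z0|z0] := eqVneq z 0; first by exists 1; rewrite ?normr1// z0 normc0 mulr0.
  exists (`|z| / z); first by rewrite normrM normr_id normfV divff// normr_eq0.
  by rewrite divfK// normCE.
have phi1 : `|u *: (repr y : H)| == 1.
  by rewrite normrZ u1 mul1r rnormE sphere_norm.
exists (Sphere phi1); split.
  by rewrite -[RHS]pi2_repr; apply/esym/pi2_eqP; exists u.
by rewrite cos_angle -{2}[y]pi2_repr cp_absinner_pi2 /= innerZr.
Qed.

(** The arc is cos(th t) psi + sin(th t) chi, where [chi] comes from [phi] by Gram-Schmidt against
    [psi]. *)
Lemma geodesic (x y : cp H) : exists g : R -> cp H,
  [/\ C1_curve g, g 0 = x, g 1 = y & cp_length g = angle x y].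
Proof.
pose psi : sphere H := repr x.
have [phi [phiy]] := aligned_repr psi y; rewrite pi2_repr.
set th := angle x y => pphi.
pose chi : H := ((sin th)^-1)%:C *: ((phi : H) - (cos th)%:C *: (psi : H)).
have psi1 : inner (psi : H) (psi : H) = 1 :> R[i].
  by rewrite inner_sqr sphere_norm expr1n.
have pchi : inner (psi : H) chi = 0 :> R[i].
  by rewrite innerZr innerBr innerZr psi1 mulr1 pphi subrr mulr0.
have chip : inner chi (psi : H) = 0 :> R[i] by rewrite inner_conj pchi rmorph0.
have sth : sin th = 0 -> th = 0.
  move=> s0; have [//|th0] := eqVneq th 0.
  have thpi : th < pi by have := angle_le_pihalf x y; have := @pi_gt0 R; rewrite -/th; lra.
  have : 0 < sin th by rewrite sin_gt0_pi// thpi andbT lt_neqAle eq_sym th0 angle_ge0.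
  by rewrite s0 ltxx.
have n2 : rnorm ((phi : H) - (cos th)%:C *: (psi : H)) = sin th.
  rewrite -pphi -[LHS]ger0_norm ?rnorm_ge0// -sqrtr_sqr sqr_rnorm_orth ?sphere_norm//.
  rewrite pphi normc_real -normrX ger0_norm ?sqr_ge0// expr1n -sin2cos2 sqrtr_sqr.
  by rewrite ger0_norm// sin_ge0_pi// angle_ge0 angle_lepi.
(* If [x = y] there is no direction to normalize and [chi] is not a unit vector, but then [th = 0]
   and the arc is constant. *)
have chi1 : th = 0 \/ inner chi chi = 1 :> R[i].
  have [s0|s0] := eqVneq (sin th) 0; [by left; exact: sth|right].
  rewrite inner_sqr rnormZ n2 normc_real normfV ger0_norm; last first.
    by rewrite sin_ge0_pi// angle_ge0 angle_lepi.
  by rewrite mulVf// expr1n.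
have phiE : (phi : H) = (cos th)%:C *: (psi : H) + (sin th)%:C *: chi.
  have [s0|s0] := eqVneq (sin th) 0.
    move/eqP: n2; rewrite s0 rnorm_eq0 subr_eq0 => /eqP ->.
    by rewrite scale0r addr0.
  by rewrite /chi scalerA -rmorphM/= mulfV// scale1r addrC subrK.
clearbody chi.
pose cc (a b : R) : H := a%:C *: (psi : H) + b%:C *: chi.
have inner_cc a b a' b' : inner (cc a b) (cc a' b') =
    (a * a')%:C + (b * b')%:C * inner chi chi :> R[i].
  rewrite /cc !innerDr !innerDl !innerZr !innerZl psi1 pchi chip !conjc_real.
  rewrite !rmorphM/=; ring.
pose c0 (t : R) := cc (cos (th * t)) (sin (th * t)).
have c1 t : `|c0 t| == 1.
  suff : rnorm (c0 t) ^+ 2 = 1.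
    move=> /eqP; rewrite sqrp_eq1 ?rnorm_ge0// => /eqP h.
    by rewrite rnormE h.
  apply: complexI; rewrite -inner_sqr inner_cc -!expr2.
  case: chi1 => [->|->]; first by rewrite !mul0r cos0 sin0 expr0n expr1n mul0r addr0.
  by rewrite mulr1 -rmorphD/= cos2Dsin2.
pose c t : sphere H := Sphere (c1 t).
pose c' t : H := cc (th * - sin (th * t)) (th * cos (th * t)).
have drv (f df : R -> R) (t : R) : (forall u : R, is_derive u 1 f (df u)) ->
    is_derive t 1 (fun s => f (th * s)) (th * df (th * t)).
  move=> fd; have thd : is_derive t 1 ( *%R th) th.
    by apply: is_derive_eq; rewrite /GRing.scale/= mulr1.
  have := @is_derive1_comp R f ( *%R th) t _ _ (fd _) thd.
  by rewrite mulrC.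
have dc t : has_deriv (fun r => c r : H) t (c' t).
  rewrite /has_deriv/= /c0 /c'.
  under eq_fun => s.
    rewrite /cc opprD addrACA -!scalerBl -!rmorphB/= scalerDr !scalerA -!rmorphM/=; over.
  apply: cvgD; apply: cvg_scalel.
  - apply: cvg_within_filter; apply: is_derive_quotient.
    exact: (drv cos (fun u => - sin u) t (@is_derive_cos R)).
  - apply: cvg_within_filter; apply: is_derive_quotient.
have c'c t : c' r @[r --> within `[0, 1] (nbhs t)] --> c' t.
  apply: cvg_within_filter.
  have tht : th * r @[r --> t] --> th * t by apply: cvgM; [exact: cvg_cst|exact: cvg_id].
  apply: cvgD; apply: cvg_scalel; apply: cvgM; try exact: cvg_cst.
  - by apply: cvgN; exact: (continuous_cvg _ (@continuous_sin R _) tht).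
  - exact: (continuous_cvg _ (@continuous_cos R _) tht).
pose g t := pi2 (c t).
have gl t : local_lift g t c c' by apply: nearW => s.
have gC1 : C1_curve g by move=> t _; exists c, c'.
exists g; split => //.
- rewrite -(pi2_repr x); congr pi2; apply: val_inj => /=.
  by rewrite /c0 mulr0 cos0 sin0 /cc scale0r scale1r addr0.
- rewrite -phiy; congr pi2; apply: val_inj => /=.
  by rewrite /c0 mulr1 phiE.
have speedE t : t \in `[0, 1] -> cp_speed g t = th.
  move=> t01; rewrite (cp_speedE t01 (gl t)) rnorm_horizontal.
  (* The coefficients are real and [psi] is orthogonal to [chi], so <c t, c' t> is real: the arc is
     horizontal and its speed is the norm of [c' t]. *)
  rewrite rinneriE -rinner_sqr /rinner /c' /= !inner_cc.
  rewrite -[RHS]ger0_norm ?angle_ge0// -sqrtr_sqr; congr Num.sqrt.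
  case: chi1 => [->|->].
    by rewrite !(mul0r, mulr0) rmorph0 !(mul0r, addr0)/= expr0n subr0.
  rewrite /= !mulr0 !mul0r !mulr1 !addr0 subr0 -[RHS]mulr1 -(cos2Dsin2 (th * t)).
  by ring.
rewrite /cp_length (@eq_Rintegral _ _ _ _ _ (cst th)); last first.
  by move=> t; rewrite inE => /speedE.
have muE : mu `[0, 1] = 1%E by rewrite lebesgue_measure_itv/= lte_fin ltr01 oppr0 adde0.
rewrite Rintegral_cst// -[RHS]mulr1; congr (_ * _).
by rewrite [LHS](congr1 fine muE).
Qed.

(** The arc attains the lower bound valid for all C^1 curves. *)
Lemma cp_distE (x y : cp H) : cp_dist x y = angle x y.
Proof.
rewrite /cp_dist; have [g [gC1 g0 g1 gl]] := geodesic x y.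
apply/eqP; rewrite eq_le; apply/andP; split.
  apply: ge_inf; last by exists g.
  by exists (angle x y) => l [h [hC1 <- <- ->]]; exact: cp_length_ge_angle.
apply: lb_le_inf; first by exists (cp_length g), g.
by move=> l [h [hC1 <- <- ->]]; exact: cp_length_ge_angle.
Qed.

End Geodesic.

(** * Distance and projection to the projective subspace of an event *)

Section Events.
#[local] Set Implicit Arguments.
#[local] Unset Strict Implicit.
Context {R : realType} {H : hilbertType R}.
Local Open Scope complex_scope.
Implicit Types (x y : cp H) (psi phi : sphere H) (E : event H).

(** Since acos decreases, a point maximizing |<x, .>| on [Y] is a nearest one. *)
Lemma cp_dist_set_min x y (Y : set (cp H)) : Y y ->
  (forall z, Y z -> cp_absinner x z <= cp_absinner x y) ->
  cp_dist_set x Y = cp_dist x y.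
Proof.
move=> Yy ymax.
have lb : lbound [set cp_dist x z | z in Y] (cp_dist x y).
  move=> _ [z Yz <-]; rewrite !cp_distE.
  by rewrite ler_acos ?cp_absinner_ge0 ?cp_absinner_le1 ?ymax.
apply/eqP; rewrite eq_le; apply/andP; split.
  by apply: ge_inf; [exists (cp_dist x y)|exists y].
by apply: lb_le_inf => //; exists (cp_dist x y), y.
Qed.

(** The range of an idempotent is its set of fixed vectors, so membership can be tested on a unit
    representative. *)
Lemma event_projP E y :
  event_proj E y <-> exists phi, pi2 phi = y /\ E (phi : H) = (phi : H).
Proof.
split=> [[v [w _ Ew] <-]|[phi [<- Ephi]]].
  by eexists; split; first reflexivity; rewrite /= linearZ -Ew event_idem.
have phi0 : (phi : H) != 0 by rewrite -rnorm_eq0 sphere_norm oner_neq0.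
exists (Nonzero phi0); first by exists (phi : H).
congr pi2; apply: val_inj => /=.
by rewrite rnormE sphere_norm invr1 scale1r.
Qed.

Lemma normc_inner_range E psi phi : E (phi : H) = (phi : H) ->
  normc (inner (psi : H) (phi : H)) = normc (inner (phi : H) (E (psi : H))).
Proof. by move=> Ephi; rewrite -event_selfadj Ephi normc_innerC. Qed.

Lemma cp_absinner_le_event E psi y : event_proj E y ->
  cp_absinner (pi2 psi) y <= rnorm (E (psi : H)).
Proof.
move=> /event_projP[phi [<- Ephi]]; rewrite cp_absinner_pi2 (normc_inner_range psi Ephi).
by rewrite (le_trans (normc_inner_le _ _))// sphere_norm mul1r.
Qed.

(** The witness is E psi / ||E psi||, which attains the bound of [cp_absinner_le_event]. *)
Lemma event_direction E psi : E (psi : H) <> 0 -> exists phi,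
  [/\ E (psi : H) = (rnorm (E (psi : H)))%:C *: (phi : H),
      event_proj E (pi2 phi) &
      cp_absinner (pi2 psi) (pi2 phi) = rnorm (E (psi : H))].
Proof.
move=> /eqP Epsi0; set n := rnorm _.
have n0 : n != 0 by rewrite rnorm_eq0.
have phi1 : `|n^-1%:C *: E (psi : H)| == 1.
  rewrite rnormE rnormZ normc_real ger0_norm ?invr_ge0 ?rnorm_ge0//.
  by rewrite mulVf.
pose phi := Sphere phi1.
have Ephi : E (phi : H) = (phi : H) by rewrite /= linearZ event_idem.
have EpsiE : E (psi : H) = n%:C *: (phi : H).
  by rewrite /= scalerA -rmorphM/= mulfV// scale1r.
exists phi; split => //; first by apply/event_projP; exists phi.
rewrite cp_absinner_pi2 (normc_inner_range psi Ephi) EpsiE innerZr inner_sqr.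
by rewrite sphere_norm expr1n mulr1 normc_real ger0_norm ?rnorm_ge0.
Qed.

Lemma cos_cp_dist_set E psi : event_proj E !=set0 ->
  cos (cp_dist_set (pi2 psi) (event_proj E)) = rnorm (E (psi : H)).
Proof.
move=> [y0 Sy0].
have [E0|/eqP/event_direction[phi [_ Sphi phiE]]] := eqVneq (E (psi : H)) 0.
  (* If E psi = 0, all points of the subspace are at the same distance pi/2, so any of them serves
     as nearest point. *)
  have absinner0 y : event_proj E y -> cp_absinner (pi2 psi) y = 0.
    move=> /(cp_absinner_le_event psi); rewrite E0 rnorm0 => h.
    by apply/eqP; rewrite eq_le h cp_absinner_ge0.
  rewrite (cp_dist_set_min Sy0) => [|z Sz]; last by rewrite !absinner0.
  by rewrite cp_distE cos_angle absinner0// E0 rnorm0.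
rewrite (cp_dist_set_min Sphi) => [|z Sz]; first by rewrite cp_distE cos_angle.
by rewrite phiE cp_absinner_le_event.
Qed.

(* The equality case of Cauchy-Schwarz makes the nearest point unique. *)
Lemma cp_projE E psi phi (n := rnorm (E (psi : H))) : E (psi : H) <> 0 ->
  E (psi : H) = n%:C *: (phi : H) -> event_proj E (pi2 phi) ->
  cp_absinner (pi2 psi) (pi2 phi) = n ->
  cp_proj (pi2 psi) (event_proj E) = pi2 phi.
Proof.
move=> /eqP E0 EpsiE Sphi phiE; rewrite /cp_proj.
have minE : cp_dist_set (pi2 psi) (event_proj E) = cp_dist (pi2 psi) (pi2 phi).
  by apply: cp_dist_set_min => // z; rewrite phiE; exact: cp_absinner_le_event.
(* The default value of [xget] is excluded, as the class of [phi] is a nearest point. *)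
case: xgetP => [_ -> [/event_projP[chi [<- Echi]]]|/(_ (pi2 phi))]; last by case.
rewrite minE !cp_distE => /(congr1 cos); rewrite !cos_angle phiE.
rewrite cp_absinner_pi2 (normc_inner_range psi Echi) => nE.
have n0 : n != 0 by rewrite rnorm_eq0.
set z := inner (chi : H) (E (psi : H)) in nE.
(* As |z| = ||E psi||, Pythagoras leaves no component of E psi orthogonal to [chi]. *)
have Ez : E (psi : H) = z *: (chi : H).
  apply/eqP; rewrite -subr_eq0 -rnorm_eq0 -sqrf_eq0 sqr_rnorm_orth ?sphere_norm//.
  by rewrite -/z nE subrr.
apply/pi2_eqP; exists (n^-1%:C * z); split.
  by rewrite normCE normcM nE normc_real ger0_norm ?invr_ge0 ?rnorm_ge0// mulVf.
by rewrite -scalerA -Ez EpsiE scalerA -rmorphM/= mulVf// scale1r.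
Qed.

(** If E psi is nonzero, its class is a point of the subspace not orthogonal to [psi]; the converse
    is the bound by ||E psi||. *)
Lemma cp_orth_event E psi : cp_orth (event_proj E) (pi2 psi) <-> E (psi : H) = 0.
Proof.
split=> [orth|E0 y].
  apply: contrapT => E0; have [phi [_ Sphi phiE]] := event_direction E0.
  have := orth _ Sphi; rewrite /cp_perp cp_absinnerC phiE => /eqP.
  by rewrite rnorm_eq0 => /eqP.
move=> /(cp_absinner_le_event psi); rewrite E0 rnorm0 /cp_perp cp_absinnerC => h.
by apply/eqP; rewrite eq_le h cp_absinner_ge0.
Qed.

End Events.

Theorem mainTheorem3 (R : realType) (H : hilbertType R) (dimH : dim_ge2 H)
    (E F : event H) (psi : sphere H) :
  let x := pi2 psi in
  let S := event_proj E in
  let S' := event_proj F in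
  ((~ cp_orth S x <-> E (psi : H) <> 0) /\
   (~ cp_orth S x -> S' !=set0 ->
    let y := cp_proj x S in
    event_prob psi E F = cos (cp_dist_set y S') ^+ 2 * cos (cp_dist_set x S) ^+ 2))
  /\
  ((cp_orth S x <-> E (psi : H) = 0) /\
   (cp_orth S x -> event_prob psi E F = 0)).
Proof.
move=> x S S'; have orthE := cp_orth_event E psi.
split; split=> //; first by rewrite orthE.
  rewrite orthE => E0 F0 y.
  have [phi [EpsiE Sphi phiE]] := event_direction E0.
  rewrite /y (cp_projE E0 EpsiE Sphi phiE) !cos_cp_dist_set//; last by exists (pi2 phi).
  (* Linearity of [F] pulls the factor ||E psi|| out of F E psi, leaving the norm of [F] at the unit
     representative [phi] of [y]. *)
  rewrite -exprMn /event_prob {1}EpsiE linearZ rnormZ normc_real.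
  by rewrite ger0_norm ?rnorm_ge0// mulrC.
by rewrite orthE /event_prob => ->; rewrite linear0 rnorm0 expr0n.
Qed.
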